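(* Let $(X,\mathcal U)$ be a uniform $P$-space, let $F(X,\mathcal U)$ be its uniform free topological group, and for $n\in\mathbb N$ let $B_n\subseteq F(X,\mathcal U)$ be the subset of all words of length at most $n$. Then $F(X,\mathcal U)$ is balanced if and only if $B_n$ is balanced for every $n\in\mathbb N$.
   Context: All topological groups and uniform spaces are assumed to be Hausdorff, and $X$ is nonempty. A uniform $P$-space is a uniform space $(X,\mathcal U)$ such that the intersection of countably many elements of $\mathcal U$ is again in $\mathcal U$. Uniform free topological group: $F(X,\mathcal U)$ is a topological group together with a uniformly continuous map $i:X\to F(X,\mathcal U)$ such that for every topological group $G$ and every uniformly continuous map $\varphi:(X,\mathcal U)\to G$ there is a unique continuous homomorphism $\Phi:F(X,\mathcal U)\to G$ with $\Phi\circ i=\varphi$; topological groups carry here their two-sided uniformity $\mathcal L_G\vee\mathcal R_G$. It is known that $F(X,\mathcal U)$ exists, that $i$ is a uniform embedding, and that algebraically $F(X,\mathcal U)$ is the free group $F(X)$ on $X$ (identified with $i(X)$). $B_n$ denotes the set of all elements of $F(X)$ whose word length with respect to $X\cup X^{-1}$ is at most $n$. For a topological group $G$, the left uniformity $\mathcal L_G$ has as base the sets $\{(x,y)\in G^2: x^{-1}y\in U\}$, and the right uniformity $\mathcal R_G$ has as base the sets $\{(x,y)\in G^2: xy^{-1}\in U\}$, where $U$ runs over the neighborhoods of the identity. For a symmetric subset $B=B^{-1}\subseteq G$, let $\mathcal L_G^B=\{\delta\cap(B\times B):\delta\in\mathcal L_G\}$ and $\mathcal R_G^B=\{\delta\cap(B\times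 B):\delta\in\mathcal R_G\}$ be the traces on $B$. $B$ is balanced if $\mathcal L_G^B=\mathcal R_G^B$; the group $G$ is balanced if $\mathcal L_G=\mathcal R_G$. *)

(* Defs.v *)
From HB Require Import structures.
From mathcomp Require Import all_boot all_classical topology.

Set Implicit Arguments.
Unset Strict Implicit.
Unset Printing Implicit Defensive.

Local Open Scope classical_set_scope.
Local Open Scope group_scope.

HB.mixin Record isTopologicalGroup G & Group G & Topological G := {
  mulg_continuous : continuous (fun xy : G * G => xy.1 * xy.2);
  invg_continuous : continuous (fun x : G => x^-1)
}.

(* Separation is not part of the structure: the Hausdorff axiom is required
   explicitly wherever a topological group is quantified over. *)
#[short(type="topologicalGroupType")]
HB.structure Definition TopologicalGroup :=
  {G of Group G & Topological G & isTopologicalGroup G}.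

Section Uniformities.
Variable G : topologicalGroupType.

Definition left_ent : set_system (G * G) :=
  filter_from (nbhs (1 : G)) (fun U => [set xy | U (xy.1^-1 * xy.2)]).

Definition right_ent : set_system (G * G) :=
  filter_from (nbhs (1 : G)) (fun U => [set xy | U (xy.1 * xy.2^-1)]).

Definition two_sided_ent : set_system (G * G) :=
  filter_from [set AB | left_ent AB.1 /\ right_ent AB.2]
    (fun AB => AB.1 `&` AB.2).

Definition trace (D : set_system (G * G)) (B : set G) : set_system (G * G) :=
  [set A `&` (B `*` B) | A in D].

(* Meant for symmetric B. *)
Definition balanced_set (B : set G) := trace left_ent B = trace right_ent B.

Definition balanced_group := left_ent = right_ent.

(* Products of at most n letters from A and its inverses. *)
Definition word_ball (A : set G) (n : nat) : set G :=
  [set g | exists w : seq G,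
    [/\ (size w <= n)%N,
        (forall x, x \in w -> A x \/ A x^-1) &
        g = \big[*%g/1]_(x <- w) x]].

Lemma word_ballV A n x : word_ball A n x -> word_ball A n x^-1.
Proof.
move=> [w [sw wA ->]]; exists (rev [seq y^-1 | y <- w]); split.
- by rewrite size_rev size_map.
- move=> y; rewrite mem_rev => /mapP[z /wA + ->].
  by rewrite invgK => -[]; [right|left].
- elim: w {sw wA} => [|y w IHw]; first by rewrite !big_nil invg1.
  rewrite big_cons invgM IHw /= rev_cons -cats1.
  by rewrite big_cat big_cons big_nil /= mulg1.
Qed.

Lemma nbhs1_mul (U : set G) : nbhs 1 U ->
  exists2 V, nbhs 1 V & forall x y, V x -> V y -> U (x * y).
Proof.
move=> U1; have := @mulg_continuous G (1, 1) U; rewrite /= mulg1 => /(_ U1).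
case=> -[V W] /= [V1 W1] VWU; exists (V `&` W); first exact: filterI.
by move=> x y [Vx _] [_ Wy]; exact: (VWU (x, y)).
Qed.

Lemma nbhs1_inv (U : set G) : nbhs 1 U -> nbhs 1 [set x | U x^-1].
Proof. by move=> U1; apply: (@invg_continuous G 1 U); rewrite invg1. Qed.

Lemma two_sided_entP E : two_sided_ent E <->
  exists2 U, nbhs (1 : G) U &
    [set xy | U (xy.1^-1 * xy.2) /\ U (xy.1 * xy.2^-1)] `<=` E.
Proof.
split=> [[[A B] [/= [U U1 UA] [V V1 VB] ABE]]|[U U1 UE]].
  exists (U `&` V); first exact: filterI.
  move=> xy /= [[Ul _] [_ Vr]]; apply: ABE; split; [exact: UA|exact: VB].
exists ([set xy : G * G | U (xy.1^-1 * xy.2)],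
        [set xy : G * G | U (xy.1 * xy.2^-1)]) => //=.
by split; exists U.
Qed.

Lemma two_sided_filter : Filter two_sided_ent.
Proof.
split.
- by apply/two_sided_entP; exists setT => //; exact: filterT.
- move=> P Q /two_sided_entP[U U1 UP] /two_sided_entP[V V1 VQ].
  apply/two_sided_entP; exists (U `&` V); first exact: filterI.
  by move=> xy [[? ?] [? ?]]; split; [apply: UP|apply: VQ].
- move=> P Q PQ /two_sided_entP[U U1 UP]; apply/two_sided_entP.
  by exists U => // xy /UP /PQ.
Qed.

Lemma two_sided_diagonal E : two_sided_ent E -> diagonal `<=` E.
Proof.
move=> /two_sided_entP[U U1 UE] [x y]; rewrite /diagonal /= => <-.
by apply: UE => /=; rewrite mulVg mulgV; split; exact: nbhs_singleton.
Qed.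

Lemma two_sided_inv E : two_sided_ent E -> two_sided_ent E^-1%relation.
Proof.
move=> /two_sided_entP[U U1 UE]; apply/two_sided_entP.
exists (U `&` [set x | U x^-1]); first exact/filterI/nbhs1_inv.
move=> [x y] /= [[_ +] [_ +]]; rewrite !invgM !invgK => Ul Ur.
by apply: UE.
Qed.

Lemma two_sided_split E : two_sided_ent E ->
  exists2 D, two_sided_ent D & (D \; D `<=` E)%relation.
Proof.
move=> /two_sided_entP[U U1 UE]; have [V V1 VU] := nbhs1_mul U1.
exists [set xy | V (xy.1^-1 * xy.2) /\ V (xy.1 * xy.2^-1)].
  by apply/two_sided_entP; exists V.
move=> [x z] [y] /= [xyl xyr] [yzl yzr]; apply: UE => /=; split.
  by have := VU _ _ xyl yzl; rewrite -mulgA mulVKg.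
by have := VU _ _ xyr yzr; rewrite mulgA mulgVK.
Qed.

Lemma nbhs_mulg (a b : G) A : nbhs (a * b) A -> nbhs b [set z | A (a * z)].
Proof.
move=> abA; have [[V W] /= [aV bW] VWA] := @mulg_continuous G (a, b) A abA.
apply: filterS bW => z Wz.
by apply: (VWA (a, z)); split => //=; exact: nbhs_singleton.
Qed.

Lemma two_sided_nbhsE : nbhs = nbhs_ two_sided_ent.
Proof.
apply/funext => x; apply/seteqP; split=> [A xA|A].
  have := @nbhs_mulg x 1 A; rewrite mulg1 => /(_ xA) xA1.
  exists [set yz | A (x * (yz.1^-1 * yz.2))].
    by apply/two_sided_entP; exists [set z | A (x * z)] => // yz [].
  by move=> y /xsectionP /=; rewrite mulgA mulgV mul1g.
move=> [E /two_sided_entP[U U1 UE] EA].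
have xl : nbhs x [set z | U (x^-1 * z)].
  by apply: nbhs_mulg; rewrite mulVg.
have xr : nbhs x [set z | U (x * z^-1)].
  have := @invg_continuous G x [set z | U (x * z)]; apply.
  by apply: nbhs_mulg; rewrite mulgV.
apply: filterS (filterI xl xr) => z [zl zr].
by apply/EA/xsectionP/UE.
Qed.

End Uniformities.

(* G with its two-sided uniformity. *)
Definition two_sided (G : topologicalGroupType) : Type := G.

HB.instance Definition _ (G : topologicalGroupType) :=
  Topological.copy (two_sided G) G.
HB.instance Definition _ (G : topologicalGroupType) :=
  @Nbhs_isUniform_mixin.Build (two_sided G) (@two_sided_ent G)
    (@two_sided_filter G) (@two_sided_diagonal G) (@two_sided_inv G)
    (@two_sided_split G) (@two_sided_nbhsE G).

Definition uniform_P_space (X : uniformType) :=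
  forall E : nat -> set (X * X),
    (forall n, entourage (E n)) -> entourage (\bigcap_n E n).

Definition uniform_free_group (X : uniformType) (F : topologicalGroupType)
    (i : X -> F) :=
  [/\ hausdorff_space F,
      unif_continuous (i : X -> two_sided F) &
      forall (G : topologicalGroupType) (phi : X -> G),
        hausdorff_space G -> unif_continuous (phi : X -> two_sided G) ->
        exists! Phi : F -> G,
          [/\ {morph Phi : x y / x * y}, continuous Phi & Phi \o i = phi]].

(* Main.v *)
From HB Require Import structures.
Require Import Defs.
From mathcomp Require Import all_boot all_classical topology.

(** Let [H] be the subgroup of [F] generated by the image of [X], topologized by
    the countable intersections of neighborhoods of [F].  As [X] is a P-space,
    [X -> H] is still uniformly continuous, so the universal property yields a
    continuous retraction [F -> H] over [F]; hence [H = F], and countable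
    intersections of neighborhoods in [F] are neighborhoods.  If all balls are
    balanced, choose for [U] and each [n] a neighborhood [V n] of [1] such that
    [x^-1 * y] in [V n] implies [x * y^-1] in [U] for [x], [y] of length at most
    [n].  Taking [y = x * v], the intersection of all the [V n] is a neighborhood
    all of whose conjugates lie in [U^-1]. *)

Local Open Scope classical_set_scope.
Local Open Scope group_scope.

Section WordBall.
Context {G : topologicalGroupType} (A : set G).

Lemma word_ball_leq m n x : (m <= n)%N -> word_ball A m x -> word_ball A n x.
Proof.
by move=> mn [w [sw wA ->]]; exists w; split=> //; exact: leq_trans mn.
Qed.

Lemma word_ballM m n x y :
  word_ball A m x -> word_ball A n y -> word_ball A (m + n) (x * y).
Proof.
move=> [v [sv vA ->]] [w [sw wA ->]]; exists (v ++ w); split.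
- by rewrite size_cat leq_add.
- by move=> z; rewrite mem_cat => /orP[/vA|/wA].
- by rewrite big_cat.
Qed.

(** Written as a union of balls so that membership yields a bound on word length. *)
Definition generated : set G := \bigcup_n word_ball A n.

Lemma sub_generated : A `<=` generated.
Proof.
move=> a Aa; exists 1%N => //; exists [:: a]; split=> //; last first.
  by rewrite big_seq1.
by move=> x; rewrite inE => /eqP ->; left.
Qed.

Lemma generated_group_closed : group_closed (mem generated).
Proof.
split; first by apply/mem_set; exists 0%N => //; exists [::]; rewrite big_nil.
move=> x y /set_mem[m _ xm] /set_mem[n _ yn]; apply/mem_set.
by exists (m + n)%N => //; exact/word_ballM/word_ballV.
Qed.

End WordBall.

(* The carrier of the subgroup generated by [A], with the P-modification of the
   subspace topology. *)
Definition generated_P {G : topologicalGroupType} (A : set G) :=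
  {x : G | x \in generated A}.

Section GeneratedP.
Context {G : topologicalGroupType} (A : set G).
Local Notation H := (generated_P A).

HB.instance Definition _ := SubChoice.copy H {x : G | x \in generated A}.
HB.instance Definition _ := SubChoice_isSubGroup.Build G (mem (generated A)) H
  (generated_group_closed A).

Definition generated_P_nbhs (h : H) : set_system H :=
  filter_from [set U : nat -> set G | forall n, nbhs (val h) (U n)]
    (fun U => val @^-1` \bigcap_n U n).

HB.instance Definition _ := hasNbhs.Build H generated_P_nbhs.

Lemma generated_P_nbhs_filter (h : H) : ProperFilter (nbhs h).
Proof.
apply: filter_from_proper => [|U hU]; last first.
  by exists h => n _; exact: nbhs_singleton.
apply: filter_from_filter => [|U V hU hV].
  by exists (fun=> setT) => n; exact: filterT.
exists (fun n => U n `&` V n); first by move=> n; exact: filterI.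
by move=> k UVk; split=> n _; have [] := UVk n I.
Qed.

Lemma generated_P_nbhs_singleton (h : H) (B : set H) : nbhs h B -> B h.
Proof. by move=> [U hU]; apply => n _; exact: nbhs_singleton. Qed.

Lemma generated_P_nbhs_nbhs (h : H) (B : set H) :
  nbhs h B -> nbhs h (nbhs^~ B).
Proof.
(* The intersection of the interiors is a neighborhood of each of its points. *)
move=> [U hU UB]; exists (fun n => (U n)°).
  by move=> n; exact: nbhs_interior.
by move=> k Uk; exists U => // n; exact: Uk.
Qed.

HB.instance Definition _ := Nbhs_isNbhsTopological.Build H
  generated_P_nbhs_filter generated_P_nbhs_singleton generated_P_nbhs_nbhs.

Lemma generated_P_mulg_continuous : continuous (fun xy : H * H => xy.1 * xy.2).
Proof.
move=> [x y] B [U xyU UB].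
(* Continuity in [G] is applied to each [U n] separately; the neighborhoods found for each factor
   are then intersected over [n]. *)
have /choice[V VU] n : exists VW : set G * set G,
    [/\ nbhs (val x) VW.1, nbhs (val y) VW.2 &
      forall a b, VW.1 a -> VW.2 b -> U n (a * b)].
  have [[V W] /= [xV yW] VWU] :=
    @mulg_continuous G (val x, val y) (U n) (xyU n).
  by exists (V, W); split=> // a b Va Wb; exact: (VWU (a, b)).
exists (val @^-1` (\bigcap_n (V n).1), val @^-1` (\bigcap_n (V n).2)).
  by split=> /=; [exists (fun n => (V n).1)|exists (fun n => (V n).2)] => // n;
    have [] := VU n.
move=> [a b] /= [Va Vb]; apply: UB => n _.
by have [_ _] := VU n; apply; [exact: Va|exact: Vb].
Qed.

Lemma generated_P_invg_continuous : continuous (fun x : H => x^-1).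
Proof.
move=> x B [U xU UB]; exists (fun n => [set y | U n y^-1]).
  by move=> n; apply: (@invg_continuous G (val x)); exact: xU.
by move=> y Uy; apply: UB => n _; exact: Uy.
Qed.

HB.instance Definition _ := isTopologicalGroup.Build H
  generated_P_mulg_continuous generated_P_invg_continuous.

Lemma generated_P_val_continuous : continuous (val : H -> G).
Proof. by move=> x B xB; exists (fun=> B) => // y /(_ 0%N); exact. Qed.

(** The universal property only reaches Hausdorff groups. The topology here is finer than the one
    induced by [G]. *)
Lemma generated_P_hausdorff : hausdorff_space G -> hausdorff_space H.
Proof.
move=> hausG x y xy; apply/val_inj/hausG => U V xU yV.
have [z [Uz Vz]] := xy _ _ (generated_P_val_continuous x U xU)
  (generated_P_val_continuous y V yV).
by exists (val z).
Qed.

End GeneratedP.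

Section FreeGroupOfPSpace.
Context {X : uniformType} {F : topologicalGroupType} {i : X -> F}.
Hypotheses (PX : uniform_P_space X) (freeF : uniform_free_group i).

Let range_generated x : i x \in generated (range i).
Proof. by apply/mem_set/sub_generated; exists x. Qed.

Let j (x : X) : generated_P (range i) := Sub (i x) (range_generated x).

(** Each [U n] pulls back along [i] to an entourage [D n] of [X], and the P-space property makes
    their intersection an entourage. *)
Let j_unif_continuous : unif_continuous (j : X -> two_sided _).
Proof.
move=> E /two_sided_entP[B [U U1 UB] BE].
pose D n := [set xy | U n ((i xy.1)^-1 * i xy.2) /\
                      U n (i xy.1 * (i xy.2)^-1)].
have : entourage (\bigcap_n D n).
  apply: PX => n; have [_ iu _] := freeF.
  apply: (iu [set xy | U n (xy.1^-1 * xy.2) /\ U n (xy.1 * xy.2^-1)]).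
  by apply/two_sided_entP; exists (U n) => //; exact: U1.
apply: filterS => xy Dxy.
by apply: BE => /=; split; apply: UB => n _; have [] := Dxy n I.
Qed.

(** For [Phi] extending [j], both [val \o Phi] and the identity are continuous endomorphisms of [F]
    extending [i], so they agree by uniqueness. *)
Lemma free_group_retraction : exists2 Phi : F -> generated_P (range i),
  continuous Phi & forall x, val (Phi x) = x.
Proof.
have [hausF iu univ] := freeF.
have [Phi [[PhiM Phic Phii] _]] :=
  univ _ j (generated_P_hausdorff _ hausF) j_unif_continuous.
exists Phi => // x; have [Psi [_ Psi_uniq]] := univ F i hausF iu.
have Psi_id : Psi = id by apply: Psi_uniq; split=> // y; exact: cvg_id.
suff Psi_val : Psi = val \o Phi.
  by rewrite -[LHS]/((val \o Phi) x) -Psi_val Psi_id.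
apply: Psi_uniq; split=> [a b|y|].
- by rewrite /= PhiM.
- by apply: continuous_comp; [exact: Phic|exact: generated_P_val_continuous].
- by rewrite -compA Phii.
Qed.

Lemma free_group_generated x : generated (range i) x.
Proof.
by have [Phi _ PhiK] := free_group_retraction; rewrite -(PhiK x); exact/set_mem/valP.
Qed.

(** The intersection is the preimage under [Phi] of its trace on the subgroup, which is a
    neighborhood of [Phi x] by the choice of topology there. *)
Lemma free_group_nbhs_bigcap (x : F) (U : nat -> set F) :
  (forall n, nbhs x (U n)) -> nbhs x (\bigcap_n U n).
Proof.
move=> xU; have [Phi Phic PhiK] := free_group_retraction.
have PhixU : nbhs (Phi x) (val @^-1` \bigcap_n U n).
  by exists U => // n; rewrite PhiK.
have := Phic x _ PhixU; congr (nbhs x).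
by apply/funext => y; rewrite -[in RHS](PhiK y).
Qed.

End FreeGroupOfPSpace.

Section Balanced.
Context {G : topologicalGroupType}.

Lemma balanced_groupS (B : set G) : balanced_group G -> balanced_set B.
Proof. by rewrite /balanced_set => ->. Qed.

(** The inverse on [v] makes the conjugate equal to [x * y^-1] for [x = g] and [y = g * v], with no
    symmetry asked of [U]. *)
Lemma balanced_group_conj :
  (forall U, nbhs (1 : G) U ->
    exists2 V, nbhs (1 : G) V & forall g v, V v -> U (g * v^-1 * g^-1)) ->
  balanced_group G.
Proof.
move=> conjG; apply/seteqP; split=> E [U U1 UE]; have [V V1 VU] := conjG U U1;
  exists V => // -[x y] /= /VU Vxy; apply: UE => /=.
  (* Conjugating the inverse of [x * y^-1] by [x^-1] gives [x^-1 * y]; for the other inclusion,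
     conjugating the inverse of [x^-1 * y] by [x] gives [x * y^-1]. *)
  by have := Vxy x^-1; rewrite invgM !invgK !mulgA mulgVK.
by have := Vxy x; rewrite invgM !invgK !mulgA mulgK.
Qed.

Lemma balanced_set_right (B U : set G) : balanced_set B -> nbhs (1 : G) U ->
  exists2 V, nbhs (1 : G) V &
    forall x y, B x -> B y -> V (x^-1 * y) -> U (x * y^-1).
Proof.
move=> balB U1.
have : trace (@right_ent G) B ([set xy | U (xy.1 * xy.2^-1)] `&` (B `*` B)).
  by exists [set xy | U (xy.1 * xy.2^-1)] => //; exists U.
(* The same set is thus the trace of a left entourage [E], and [V] is a neighborhood witnessing
   this. *)
rewrite -balB => -[E [V V1 VE] EB]; exists V => // x y Bx By Vxy.
have : (E `&` (B `*` B)) (x, y) by split=> //; exact: VE.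
by rewrite EB => -[].
Qed.

Lemma balanced_group_word_ball (A : set G) :
  (forall U : nat -> set G, (forall n, nbhs (1 : G) (U n)) ->
    nbhs (1 : G) (\bigcap_n U n)) ->
  (forall g, generated A g) ->
  (forall n, balanced_set (word_ball A n)) -> balanced_group G.
Proof.
move=> PG genA balA; apply: balanced_group_conj => U U1.
have /choice[V VU] n : exists V, nbhs (1 : G) V /\
    forall x y, word_ball A n x -> word_ball A n y ->
      V (x^-1 * y) -> U (x * y^-1).
  by have [V ? ?] := balanced_set_right _ _ (balA n) U1; exists V.
exists (\bigcap_n V n); first by apply: PG => n; have [] := VU n.
move=> g v Vv; have [m _ gm] := genA g; have [n _ vn] := genA v.
(* Both [g] and [g * v] have length at most [m + n]; this index varies with [g] and [v], hence the
   intersection of all [V n]. *)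
have [_] := VU (m + n)%N => /(_ g (g * v)).
rewrite mulgA mulVg mul1g invgM mulgA; apply; last exact: Vv.
  exact: word_ball_leq (leq_addr n m) gm.
exact: word_ballM.
Qed.

End Balanced.

Theorem corollary4p3 (X : uniformType) (X0 : [set: X] !=set0)
    (hausX : hausdorff_space X) (PX : uniform_P_space X)
    (F : topologicalGroupType) (i : X -> F) (freeF : uniform_free_group i) :
  balanced_group F <->
  forall n : nat, balanced_set (word_ball (range i) n).
Proof.
split=> [balF n|]; first exact: balanced_groupS.
apply: balanced_group_word_ball.
  by move=> U; exact: (free_group_nbhs_bigcap PX freeF).
exact: (free_group_generated PX freeF).
Qed.
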